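(* Let $i,j\in\{0,4,5\}$. For any space $X$ the following conditions are equivalent: (1) $X$ is a weak $(i,j)$-structured space; (2) there exist spaces $K$ and $M$ such that $K$ is compact, $M$ is an $(i,j)$-structured space, and $X$ is a continuous image of a closed subspace of $K\times M$; (3) $X$ belongs to every class $\mathscr{P}$ of spaces satisfying the following conditions: (a) $\mathscr{P}$ contains all compact spaces and all $(i,j)$-structured spaces; (b) $\mathscr{P}$ is invariant under closed subspaces and continuous images; (c) for every compact space $K$ and every $Z\in\mathscr{P}$, the product $K\times Z$ belongs to $\mathscr{P}$; (4) there is an upper semicontinuous compact-valued onto map $\varphi: M\rightarrow X$ for some $(i,j)$-structured space $M$.
   Context: All spaces are Tychonoff. A perfect map is a continuous closed map with compact fibres. A space $X$ is a Lindelöf $\Sigma$-space if there exists a space $Z$ which maps continuously onto $X$ and perfectly onto a second countable space. Let $\mathscr{P}_{0}$ be the class of $\sigma$-compact spaces, $\mathscr{P}_{4}$ the class of Lindelöf $\Sigma$-spaces, and $\mathscr{P}_{5}$ the class of compact spaces. A space $X$ is $(i,j)$-structured if there is a subspace $Y\subset X$ with $Y\in\mathscr{P}_{i}$ such that for each open set $U$ of $X$ with $Y\subset U$, the subspace $X\setminus U$ belongs to $\mathscr{P}_{j}$. A space $X$ is a weak $(i,j)$-structured space if there exists a space $Y$ which maps continuously onto $X$ and perfectly onto an $(i,j)$-structured space. A multivalued map $\varphi: M\rightarrow X$ is a map from $M$ to the family of subsets of $X$. It is compact-valued if $\varphi(x)$ is compact for each $x\in M$; it is onto if $\bigcup\{\varphi(x):x\in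 M\}=X$; it is upper semicontinuous if $\{x\in M:\varphi(x)\subset U\}$ is open in $M$ for every open $U\subset X$. *)

(* Defs.v *)
From HB Require Import structures.
From mathcomp Require Import all_boot all_order all_algebra.
From mathcomp Require Import all_classical topology urysohn.

Set Implicit Arguments.
Unset Strict Implicit.
Unset Printing Implicit Defensive.

Local Open Scope classical_set_scope.

(* Topological spaces of the library carry no separation axiom and may be      *)
(* empty; below, every space that is quantified over is explicitly required to *)
(* be Tychonoff.  Subspaces are the types [set_type A] with the initial        *)
(* topology of the inclusion, so they inherit this property.                   *)

(* By [uniform_separatorP], [completely_regular_space] says that points and    *)
(* closed sets are separated by continuous functions into [0, 1].              *)
Definition tychonoff_space (X : topologicalType) : Prop :=
  accessible_space X /\ completely_regular_space X.

Definition closed_map (X Y : topologicalType) (f : X -> Y) : Prop :=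
  forall A : set X, closed A -> closed (f @` A).

Definition perfect_map (X Y : topologicalType) (f : X -> Y) : Prop :=
  [/\ continuous f, closed_map f & forall y, compact (f @^-1` [set y])].

Definition maps_continuously_onto (X Y : topologicalType) : Prop :=
  exists2 f : X -> Y, continuous f & range f = [set: Y].

Definition maps_perfectly_onto (X Y : topologicalType) : Prop :=
  exists2 f : X -> Y, perfect_map f & range f = [set: Y].

Definition compact_space (X : topologicalType) : Prop := compact [set: X].

Definition sigma_compact_space (X : topologicalType) : Prop :=
  exists2 F : nat -> set X,
    (forall n, compact (F n)) & \bigcup_n F n = [set: X].

Definition lindelof_sigma_space (X : topologicalType) : Prop :=
  exists Z S : topologicalType,
    [/\ tychonoff_space Z, tychonoff_space S, @second_countable S,
        maps_continuously_onto Z X & maps_perfectly_onto Z S].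

(* The numbering of the classes is partial: only 0, 4 and 5 are meaningful. *)
Definition space_class (i : nat) : topologicalType -> Prop :=
  match i with
  | 0 => sigma_compact_space
  | 4 => lindelof_sigma_space
  | 5 => compact_space
  | _ => fun=> False
  end.

Definition structured (i j : nat) (X : topologicalType) : Prop :=
  exists2 Y : set X, space_class i (set_type Y) &
    forall U : set X, open U -> Y `<=` U -> space_class j (set_type (~` U)).

Definition weakly_structured (i j : nat) (X : topologicalType) : Prop :=
  exists Y S : topologicalType,
    [/\ tychonoff_space Y, tychonoff_space S, structured i j S,
        maps_continuously_onto Y X & maps_perfectly_onto Y S].

Definition contains_compact_and_structured (i j : nat)
    (P : topologicalType -> Prop) : Prop :=
  (forall K : topologicalType, tychonoff_space K -> compact_space K -> P K) /\
  (forall M : topologicalType, tychonoff_space M -> structured i j M -> P M).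

Definition closed_subspace_invariant (P : topologicalType -> Prop) : Prop :=
  forall Z : topologicalType, tychonoff_space Z -> P Z ->
  forall F : set Z, closed F -> P (set_type F).

Definition continuous_image_invariant (P : topologicalType -> Prop) : Prop :=
  forall Z W : topologicalType, tychonoff_space Z -> tychonoff_space W ->
  P Z -> maps_continuously_onto Z W -> P W.

Definition compact_product_invariant (P : topologicalType -> Prop) : Prop :=
  forall K Z : topologicalType, tychonoff_space K -> tychonoff_space Z ->
  compact_space K -> P Z -> P (K * Z)%type.

(* Multivalued maps from M to X are functions M -> set X; empty values are     *)
(* allowed.                                                                    *)
Definition compact_valued (M X : topologicalType) (phi : M -> set X) : Prop :=
  forall m, compact (phi m).

Definition multivalued_onto (M X : topologicalType) (phi : M -> set X) : Prop :=
  \bigcup_m phi m = [set: X].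

Definition upper_semicontinuous (M X : topologicalType) (phi : M -> set X) :
    Prop :=
  forall U : set X, open U -> open [set m | phi m `<=` U].

(* Main.v *)
Require Import Defs.
From HB Require Import structures.
From mathcomp Require Import all_boot all_order all_algebra.
From mathcomp Require Import all_classical topology urysohn.
From mathcomp Require Import reals normed_module Rstruct.

(* For (1) => (2), a Tychonoff space Y injects continuously into a cube K; if f *)
(* is a perfect map from Y onto S, pairing it with the injection into K gives   *)
(* a closed injection of Y into K * S.  For (3) => (4), the spaces satisfying   *)
(* (4) form a class as in (3).  For (4) => (1), the graph of phi projects onto  *)
(* X and, by the tube lemma, perfectly into M.                                  *)

Import numFieldTopology.Exports.

Set Implicit Arguments.
Unset Strict Implicit.
Unset Printing Implicit Defensive.

Local Open Scope classical_set_scope.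

(** Structuredness is carried along as a property of the parameter space; it has to be proved only
    for spaces with at most one point. The rest is general topology. Pairing a perfect map with an
    injection into a compact space gives a closed injection ([tychonoff_compact_injection],
    [closed_map_pair]), so its domain is a copy of a closed subspace of a product as in (2). Such
    spaces and their images arise by the operations listed in (3). Condition (4) is stable under the
    same operations, so (3) can be applied to the class it defines; [tube] handles products. Upper
    semicontinuity and compact values make the projection of the graph perfect
    ([graph_projection_perfect]), which leads back to (1). *)

(** * Permanence and separation properties of Tychonoff spaces *)

Lemma tychonoff_subspace (X : topologicalType) (A : set X) :
  tychonoff_space X -> tychonoff_space (set_type A).
Proof.
move=> [aX cX]; split; last first.
  (* A completely regular topology is induced by a uniformity. Uniformities pass to subspaces, and
     uniform spaces are completely regular. *)
  pose U := @completely_regular_uniformity.type Rdefinitions.R X cX.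
  exact: (@uniform_completely_regular Rdefinitions.R (set_type (A : set U))).
move=> x y xy; have /aX[V [oV Vx Vy]] : val x != val y by [].
exists (set_val @^-1` V); split; first by exists V.
- by rewrite inE; rewrite inE in Vx.
- by rewrite inE; rewrite inE in Vy.
Qed.

Lemma tychonoff_prod (X Y : topologicalType) :
  tychonoff_space X -> tychonoff_space Y -> tychonoff_space (X * Y)%type.
Proof.
move=> [aX cX] [aY cY]; split; last first.
  pose U := @completely_regular_uniformity.type Rdefinitions.R X cX.
  pose V := @completely_regular_uniformity.type Rdefinitions.R Y cY.
  exact: (@uniform_completely_regular Rdefinitions.R (U * V)%type).
move=> [a b] [c d]; rewrite xpair_eqE negb_and => /orP[/aX|/aY] [V [oV]];
  rewrite !inE => Va nVc.
- exists (fst @^-1` V); rewrite !inE; split=> //.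
  by apply: open_comp => // p _; exact: cvg_fst.
- exists (snd @^-1` V); rewrite !inE; split=> //.
  by apply: open_comp => // p _; exact: cvg_snd.
Qed.

Lemma tychonoff_regular (X : topologicalType) :
  tychonoff_space X -> regular_space X.
Proof.
move=> [_ cX].
exact: (@separation_axioms.uniform_regular
  (@completely_regular_uniformity.type Rdefinitions.R X cX)).
Qed.

Lemma tychonoff_hausdorff (X : topologicalType) :
  tychonoff_space X -> hausdorff_space X.
Proof.
move=> tX p q pq; apply: contrapT => npq.
have /accessible_closed_set1/(_ q)/closed_openC oq := tX.1.
have /(tychonoff_regular tX)[V Vp Vq] : nbhs p (~` [set q]).
  exact: open_nbhs_nbhs.
by apply: (Vq q) => // B; exact: pq.
Qed.

(** * Compact sets, tubes and closed maps *)

(** A filter on the subspace is pushed forward to [X]. Its cluster point there lies in [C], hence in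
    [A], and neighbourhoods in [A] are traces of those in [X]. *)
Lemma compact_preimage_val (X : topologicalType) (A C : set X) :
  C `<=` A -> compact C -> compact (set_val @^-1` C : set (set_type A)).
Proof.
move=> CA cC F PF FC.
have [p [Cp clp]] := cC (fmap set_val F) _ FC.
exists (exist _ p (mem_set (CA _ Cp))); split=> //.
move=> P Q FP [_ [[V oV <-] /= Vp VQ]].
have : fmap set_val F (set_val @` P).
  by apply: (@filterS _ F _ P) => // t Pt; exists t.
move=> /clp/(_ (open_nbhs_nbhs (conj oV Vp)))[_ [[x Px <-] Vx]].
by exists x; split=> //; exact: VQ.
Qed.

Lemma compact_space_set_type (X : topologicalType) (A : set X) :
  compact A -> compact_space (set_type A).
Proof.
move=> cA; rewrite /compact_space (_ : [set: A] = set_val @^-1` A).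
  exact: compact_preimage_val.
by apply/seteqP; split=> // x _; exact: set_valP.
Qed.

Lemma tube (X Y : topologicalType) (x : X) (C : set Y) (U : set (X * Y)) :
  compact C -> open U -> [set x] `*` C `<=` U ->
  exists2 W, nbhs x W & exists2 V, open V & C `<=` V /\ W `*` V `<=` U.
Proof.
move=> /compact_near_coveringP cC oU xCU.
(* Compactness is used as a near-covering property along the filter of ever smaller neighbourhoods
   [W] of [x]: each point of [C] is eventually in [P W], so all of [C] is in a single [P W], which
   serves as [V]. *)
pose P W := interior [set z : Y | forall w : X, W w -> U (w, z)].
have : \forall W \near powerset_filter_from (nbhs x), C `<=` P W.
  apply: (cC _ _ P) => y Cy.
  have : nbhs (x, y) U by apply: open_nbhs_nbhs; split=> //; exact: xCU.
  case=> -[W V] /= [Wx Vy] WVU.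
  exists (interior V, [set W' | nbhs x W' /\ W' `<=` W]).
    by split=> /=; [exact: nbhs_interior | exact: powerset_filter_fromP].
  move=> [z W'] /= [Vz [_ W'W]]; apply: filterS Vz => t Vt w W'w.
  by apply: WVU; split=> //=; exact: W'W.
move/near_powerset_filter_fromP => [A B AB|W Wx CPW].
  by move=> CP z Cz; apply: filterS (CP _ Cz) => t Bt w /AB/Bt.
exists W => //; exists (P W); first exact: open_interior.
split=> // -[w z] /= [Ww /interior_subset]; exact.
Qed.

Lemma closed_map_nbhs (X Y : topologicalType) (f : X -> Y) (y : Y)
    (U : set X) :
  closed_map f -> open U -> f @^-1` [set y] `<=` U ->
  exists2 V, nbhs y V & f @^-1` V `<=` U.
Proof.
move=> clf oU fyU; exists (~` (f @` ~` U)).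
  apply: open_nbhs_nbhs; split; first exact/closed_openC/clf/open_closedC.
  by move=> [x nUx fxy]; exact/nUx/fyU.
by move=> x /= nfx; apply: contrapT => nUx; apply: nfx; exists x.
Qed.

Lemma closed_map_pair (X K Y : topologicalType) (e : X -> K) (f : X -> Y) :
  tychonoff_space K -> continuous e -> perfect_map f ->
  closed_map (fun x => (e x, f x)).
Proof.
move=> tK ce [cf clf cptf] A clA [k y] clky; apply: contrapT => nky.
pose C := f @^-1` [set y] `&` A.
have cC : compact (e @` C).
  apply: continuous_compact; first exact: continuous_subspaceT.
  exact: compact_closedI.
have /compact_closed/closed_openC oeC := cC.
have nkC : nbhs k (~` (e @` C)).
  apply: open_nbhs_nbhs; split; first exact/oeC/tychonoff_hausdorff.
  by move=> [x [fxy Ax] exk]; apply: nky; exists x => //; rewrite exk fxy.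
have [U Uk UC] := tychonoff_regular tK nkC.
have [||V Vy fV] := @closed_map_nbhs _ _ f y (e @^-1` (~` closure U) `|` ~` A)
    clf.
- apply: openU; last exact: closed_openC.
  by apply: open_comp => [x _|]; [exact: ce | exact/closed_openC/closed_closure].
- move=> x fxy; have [Ax|] := pselect (A x); last by right.
  by left => /UC; apply; exists x.
have [_ [[x Ax <-] [Uex Vfx]]] : (fun x => (e x, f x)) @` A `&` U `*` V !=set0.
  by apply: clky; exists (U, V).
by case: (fV x Vfx) => // nUex; exact/nUex/subset_closure.
Qed.

(** For [m] outside the image of a closed set, the tube lemma encloses [[set m]]*[phi m] in a box
    [W]*[V] missing that set; upper semicontinuity keeps the nearby values inside [V]. The fibre
    over [m] is a copy of [phi m]. *)
Lemma graph_projection_perfect (M X : topologicalType) (phi : M -> set X) :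
  upper_semicontinuous phi -> compact_valued phi ->
  perfect_map (fun p : set_type [set p : M * X | phi p.1 p.2] => (val p).1).
Proof.
move=> usc cv; split.
- move=> p; apply: continuous_comp; first exact: initial_continuous.
  exact: cvg_fst.
- move=> A clA.
  have [A' clA' AE] : exists2 A', closed A' & A = set_val @^-1` A'.
    have [V oV VE] := closed_openC clA.
    exists (~` V); first exact: open_closedC.
    by rewrite -[A]setCK -VE.
  rewrite -openC openE => m nm.
  have [||W Wm [V oV [phiV WV]]] := @tube _ _ m (phi m) (~` A') (cv m).
  + exact: closed_openC.
  + move=> [_ x] [/= -> phix] A'x; apply: nm.
    by exists (exist _ (m, x) (mem_set phix)) => //; rewrite AE.
  have : nbhs m [set m' | phi m' `<=` V].
    by apply: open_nbhs_nbhs; split=> //; exact: usc.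
  apply: filterS2 Wm => m' Wm' phiV' [[[m1 x] /= p] Ap m1E].
  have phix : phi m1 x := set_mem p.
  rewrite AE /= in Ap; apply: (WV (m1, x)) Ap; split=> /=.
    by rewrite m1E.
  by rewrite m1E in phix; exact: phiV'.
- move=> m.
  rewrite (_ : _ @^-1` _ = set_val @^-1` ([set m] `*` phi m)).
    apply: compact_preimage_val; first by move=> [_ x] [/= ->].
    by apply: compact_setX => //; exact: compact_set1.
  apply/seteqP; split=> [[[m1 x] /= p] /= m1E|p [/= -> //]].
  by split=> //; rewrite -m1E; exact: set_mem p.
Qed.

(** * Injection into a cube, and closed subspaces of products *)

Lemma tychonoff_compact_injection (R : realType) (X : topologicalType) :
  tychonoff_space X ->
  exists K : topologicalType, [/\ tychonoff_space K, compact_space K &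
    exists2 e : X -> K, continuous e & injective e].
Proof.
move=> [aX cX].
(* The cube has one coordinate for each continuous function from [X] to the unit interval, and [e]
   is evaluation. It is taken inside a power of [R], whose uniformity makes it completely
   regular. *)
pose I := set_type [set f : X -> R |
  continuous f /\ range f `<=` `[0%R, 1%R]].
pose T : uniformType := prod_topology (fun _ : I => R).
pose A : set T := [set h | forall i, `[0%R, 1%R]%classic (h i)].
have tT : tychonoff_space T.
  split; last exact: (@uniform_completely_regular R).
  apply: hausdorff_accessible; apply: hausdorff_product => _.
  exact: Rhausdorff.
exists (set_type A); split; first exact: tychonoff_subspace.
  apply: compact_space_set_type.
  refine (@tychonoff I (fun=> R) (fun=> `[0%R, 1%R]%classic) _) => _.
  exact: segment_compact.
have eA x : A (fun i => val i x).
  by move=> i; apply: (set_valP i).2; exists x.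
exists (fun x => exist _ (fun i => val i x) (mem_set (eA x))).
  apply: continuous_comp_initial => x; apply/cvg_sup => i.
  apply: (@continuous_comp_initial _ _ _ (fun h : T => h i)).
  exact: (set_valP i).1.
move=> x y [] exy; apply: contrapT => nxy.
have /(@uniform_separatorP _ R)[f [cf f01 f0 f1]] :=
  cX x _ (accessible_closed_set1 aX (x := y)) nxy.
have If : [set f : X -> R | continuous f /\ range f `<=` `[0%R, 1%R]] f by [].
have fxy : f x = f y := congr1 (fun h => h (exist _ f (mem_set If))) exy.
have fx0 : f x = 0%R by apply: f0; exists x.
have fy1 : f y = 1%R by apply: f1; exists y.
by move: fxy; rewrite fx0 fy1 => /eqP; rewrite eq_sym GRing.oner_eq0.
Qed.

Lemma weakly_structured_closed_subspace i j (X : topologicalType) :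
  weakly_structured i j X ->
  exists (K M : topologicalType) (F : set (K * M)%type),
      [/\ tychonoff_space K /\ tychonoff_space M,
          compact_space K,
          structured i j M,
          closed F
        & maps_continuously_onto (set_type F) X].
Proof.
move=> [Y [S [tY tS sS [p cp pX] [f pf fS]]]].
have [K [tK cK [e ce ie]]] := tychonoff_compact_injection Rdefinitions.R tY.
pose g y := (e y, f y).
have clg : closed_map g by exact: closed_map_pair.
exists K, S, (range g); split => //; first exact/clg/closedT.
(* The inverse of [g] on its range is continuous since [g] is closed: the preimage of a closed [C]
   under [p \o ginv] is the trace of the closed set [g @] (p @^-1[C)]. *)
pose ginv (z : set_type (range g)) := projT1 (cid2 (set_valP z)).
have ginvK z : g (ginv z) = val z by rewrite /ginv; case: cid2.
exists (p \o ginv).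
  apply/continuous_closedP => C clC.
  rewrite (_ : _ @^-1` C = set_val @^-1` (g @` (p @^-1` C))).
    apply: closed_comp => [z _|]; first exact: initial_continuous.
    by apply: clg; move/continuous_closedP: cp; exact.
  apply/seteqP; split=> [z Cz|z [y Cy gy]] /=; first by exists (ginv z).
  suff -> : ginv z = y by [].
  have : g (ginv z) = g y := etrans (ginvK z) (esym gy).
  by case=> /ie.
apply/seteqP; split=> // x _.
have [y _ <-] : range p x by rewrite pX.
have gy : range g (g y) by exists y.
exists (exist _ (g y) (mem_set gy)) => //=; congr p.
by apply: ie; have := ginvK (exist _ (g y) (mem_set gy)) => -[].
Qed.

(** * The class of upper semicontinuous compact-valued images *)

(** Condition (4) as a predicate on spaces, to be used as the class in (3). *)
Definition usc_compact_image (i j : nat) (X : topologicalType) : Prop :=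
  exists (M : topologicalType) (phi : M -> set X),
    [/\ tychonoff_space M, structured i j M, upper_semicontinuous phi,
        compact_valued phi & multivalued_onto phi].

(** One-point spaces parametrize compact spaces, and the empty space is a separate case in the
    return to (1). *)
Lemma subsingleton_tychonoff (X : topologicalType) :
  (forall x y : X, x = y) -> tychonoff_space X.
Proof.
move=> X1; split=> [x y|x B clB nBx]; first by rewrite (X1 x y) eqxx.
have -> : B = set0.
  by apply/seteqP; split=> // y; rewrite (X1 y x).
apply/(@uniform_separatorP _ Rdefinitions.R); exists (fun=> 0%R); split.
- by move=> y; exact: cvg_cst.
- by move=> _ [y _ <-] /=; rewrite in_itv /= Order.POrderTheory.lexx Num.Theory.ler01.
- by move=> _ [y _ <-].
- by rewrite image_set0.
Qed.

Lemma subsingleton_class i (X : topologicalType) :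
  i \in [:: 0; 4; 5] -> (forall x y : X, x = y) -> space_class i X.
Proof.
move=> hi X1.
have cX : compact_space X.
  have [[x _]|X0] := pselect ([set: X] !=set0).
    rewrite /compact_space (_ : [set: X] = [set x]); first exact: compact_set1.
    by apply/seteqP; split.
  rewrite /compact_space (_ : [set: X] = set0); first exact: compact0.
  by apply/seteqP; split=> // x; case: X0; exists x.
have tX := subsingleton_tychonoff X1.
move: hi; rewrite !inE => /or3P[] /eqP-> //=.
  by exists (fun=> setT) => //; apply/seteqP; split=> // x _; exists 0%N.
have idX : range (@id X) = setT by rewrite image_id.
exists X, X; split=> //.
- exists open; last first.
    by split=> // x A; rewrite nbhsE => -[U [oU Ux] UA]; exists U.
  apply: (@sub_countable _ _ _ [set set0; setT]).
    apply: subset_card_le => A _.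
    have [[x Ax]|A0] := pselect (A !=set0).
      by right; apply/seteqP; split=> // y _; rewrite (X1 y x).
    by left; apply/seteqP; split=> // x Ax; apply: A0; exists x.
  by apply: finite_set_countable; exact: finite_set2.
- by exists id => // x.
- exists id => //; split=> [x //|A|x]; first by rewrite image_id.
  by rewrite (_ : _ @^-1` _ = [set x]) //; exact: compact_set1.
Qed.

Lemma subsingleton_structured i j (X : topologicalType) :
  i \in [:: 0; 4; 5] -> j \in [:: 0; 4; 5] ->
  (forall x y : X, x = y) -> structured i j X.
Proof.
move=> hi hj X1; exists setT => [|U _ _]; apply: subsingleton_class => // x y;
  exact/val_inj/X1.
Qed.

Lemma usc_compact_image_compact_structured i j :
  i \in [:: 0; 4; 5] -> j \in [:: 0; 4; 5] ->
  contains_compact_and_structured i j (usc_compact_image i j).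
Proof.
move=> hi hj; split=> [K tK cK|M tM sM].
  (* A compact space is the single value of a constant map on a one-point space. *)
  pose M := set_type [set true].
  have M1 (x y : M) : x = y.
    by apply/val_inj; rewrite (set_valP x) (set_valP y).
  exists M, (fun=> setT); split.
  - exact: subsingleton_tychonoff.
  - exact: subsingleton_structured.
  - move=> U oU; have [KU|nKU] := pselect ([set: K] `<=` U).
      by rewrite (_ : [set _ | _] = setT); [exact: openT | apply/seteqP; split].
    by rewrite (_ : [set _ | _] = set0); [exact: open0 | apply/seteqP; split].
  - by move=> _.
  - apply/seteqP; split=> // x _.
    by exists (exist (fun b => b \in [set true]) true (mem_set erefl)).
exists M, (fun m => [set m]); split=> //.
- move=> U oU; rewrite (_ : [set _ | _] = U) //.
  by apply/seteqP; split=> [m|m Um _ ->//]; apply.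
- by move=> m; exact: compact_set1.
- by apply/seteqP; split=> // m _; exists m.
Qed.

Lemma usc_compact_image_closed_subspace i j :
  closed_subspace_invariant (usc_compact_image i j).
Proof.
move=> Z tZ [M [phi [tM sM usc cv onto]]] F clF.
exists M, (fun m => set_val @^-1` (phi m)); split=> //.
- move=> _ [V oV <-].
  (* An open set of [F] is enlarged by the open complement of [F], so that upper semicontinuity in
     [Z] applies. *)
  rewrite (_ : [set _ | _] = [set m | phi m `<=` V `|` ~` F]).
    by apply: usc; apply: openU => //; exact: closed_openC.
  apply/seteqP; split=> [m /= phiV z phiz|m /= phiV z /phiV[//|]].
    have [Fz|] := pselect (F z); last by right.
    by left; apply: (phiV (exist _ z (mem_set Fz))).
  by move=> /(_ (set_valP z)).
- move=> m; rewrite (_ : _ @^-1` _ = set_val @^-1` (phi m `&` F)).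
    by apply: compact_preimage_val; [exact: subIsetr | exact: compact_closedI].
  by apply/seteqP; split=> [z|z []//]; split=> //; exact: set_valP.
- apply/seteqP; split=> // z _.
  have [m _ phiz] : (\bigcup_m phi m) (val z) by rewrite onto.
  by exists m.
Qed.

Lemma usc_compact_image_continuous_image i j :
  continuous_image_invariant (usc_compact_image i j).
Proof.
move=> Z W tZ tW [M [phi [tM sM usc cv onto]]] [f cf fW].
exists M, (fun m => f @` phi m); split=> //.
- move=> U oU; rewrite (_ : [set _ | _] = [set m | phi m `<=` f @^-1` U]).
    by apply: usc; apply: open_comp => // z _; exact: cf.
  by apply/seteqP; split=> m /=; rewrite image_subP.
- by move=> m; apply: continuous_compact => //; exact: continuous_subspaceT.
- apply/seteqP; split=> // w _; have [z _ <-] : range f w by rewrite fW.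
  have [m _ phiz] : (\bigcup_m phi m) z by rewrite onto.
  by exists m => //; exists z.
Qed.

Lemma usc_compact_image_compact_product i j :
  compact_product_invariant (usc_compact_image i j).
Proof.
move=> K Z tK tZ cK [M [phi [tM sM usc cv onto]]].
exists M, (fun m => setT `*` phi m); split=> //.
- move=> U oU.
  (* [V] is open by the tube lemma, as [K] is compact; coordinates are swapped below because [tube]
     has its compact factor second. *)
  pose V := [set z | forall k : K, U (k, z)].
  rewrite (_ : [set _ | _] = [set m | phi m `<=` V]).
    apply: usc; rewrite openE => z Vz.
    have [||W Wz [T oT [KT WT]]] :=
      @tube _ _ z setT ((fun p : Z * K => (p.2, p.1)) @^-1` U) cK.
    + by apply: open_comp => // p _;
      apply: cvg_pair; [exact: cvg_snd | exact: cvg_fst].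
    + by move=> [_ k] [/= -> _]; exact: Vz.
    by apply: filterS Wz => z' Wz' k; apply: (WT (z', k)); split=> //; exact: KT.
  apply/seteqP; split=> m /= phiU; first by move=> z phiz k; exact: phiU.
  by move=> [k z] [_ /phiU]; exact.
- by move=> m; exact: compact_setX.
- apply/seteqP; split=> // -[k z] _.
  have [m _ phiz] : (\bigcup_m phi m) z by rewrite onto.
  by exists m.
Qed.

(** * From multivalued maps back to perfect maps *)

Lemma usc_compact_image_weakly_structured i j (X : topologicalType) :
  i \in [:: 0; 4; 5] -> j \in [:: 0; 4; 5] -> tychonoff_space X ->
  usc_compact_image i j X -> weakly_structured i j X.
Proof.
move=> hi hj tX [M [phi [tM sM usc cv onto]]].
(* An empty [X] is itself structured, and its identity is perfect; otherwise a base point [x0] is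
   available. *)
have [[x0 _]|X0] := pselect ([set: X] !=set0); last first.
  have X1 (x y : X) : x = y by exfalso; apply: X0; exists x.
  exists X, X; split=> //; first exact: subsingleton_structured.
  - by exists id => //; [move=> x | apply/seteqP; split=> // x _; exists x].
  - exists id; last by apply/seteqP; split=> // x _; exists x.
    by split=> [x //|A|x]; [rewrite image_id | exfalso; apply: X0; exists x].
(* Adding a point x0 to all the values makes the projection onto M surjective *)
(* even if phi takes empty values.                                            *)
pose psi m := phi m `|` [set x0].
have uscp : upper_semicontinuous psi.
  move=> U oU; have [Ux0|nUx0] := pselect (U x0).
    rewrite (_ : [set _ | _] = [set m | phi m `<=` U]); first exact: usc.
    apply/seteqP; split=> m /=; first by move=> psiU x phix; apply: psiU; left.
    by move=> phiU x [/phiU//|->].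
  rewrite (_ : [set _ | _] = set0); first exact: open0.
  by apply/seteqP; split=> // m /= psiU; apply: nUx0; apply: psiU; right.
have cvp : compact_valued psi.
  by move=> m; apply: compactU => //; exact: compact_set1.
exists (set_type [set p : M * X | psi p.1 p.2]), M; split=> //.
- exact/tychonoff_subspace/tychonoff_prod.
- exists (fun p => (val p).2).
    move=> p; apply: continuous_comp; first exact: initial_continuous.
    exact: cvg_snd.
  apply/seteqP; split=> // x _.
  have [m _ phix] : (\bigcup_m phi m) x by rewrite onto.
  have psix : [set p : M * X | psi p.1 p.2] (m, x) by left.
  by exists (exist _ (m, x) (mem_set psix)).
- exists (fun p => (val p).1); first exact: graph_projection_perfect.
  apply/seteqP; split=> // m _.
  have psix : [set p : M * X | psi p.1 p.2] (m, x0) by right.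
  by exists (exist _ (m, x0) (mem_set psix)).
Qed.

Theorem theorem5p4 (i j : nat) (hi : i \in [:: 0; 4; 5])
    (hj : j \in [:: 0; 4; 5]) (X : topologicalType) (hX : tychonoff_space X) :
  [<->
    (* (1) *)
    weakly_structured i j X;
    (* (2) *)
    exists (K M : topologicalType) (F : set (K * M)%type),
      [/\ tychonoff_space K /\ tychonoff_space M,
          compact_space K,
          structured i j M,
          closed F
        & maps_continuously_onto (set_type F) X];
    (* (3) *)
    forall P : topologicalType -> Prop,
      contains_compact_and_structured i j P ->
      closed_subspace_invariant P ->
      continuous_image_invariant P ->
      compact_product_invariant P ->
      P X;
    (* (4) *)
    exists (M : topologicalType) (phi : M -> set X),
      [/\ tychonoff_space M,
          structured i j M,
          upper_semicontinuous phi,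
          compact_valued phi
        & multivalued_onto phi] ].
Proof.
tfae.
- exact: weakly_structured_closed_subspace.
(* The class contains [M] by (a), [K * M] by (c), and then [F] and [X] by (b). *)
- move=> [K [M [F [[tK tM] cK sM clF FX]]]] P [_ Pstruct] Pclosed Pimage Pprod.
  have tKM := tychonoff_prod tK tM.
  apply: (Pimage (set_type F)) => //; first exact: tychonoff_subspace.
  by apply: Pclosed => //; apply: Pprod => //; exact: Pstruct.
- move=> /(_ (usc_compact_image i j)); apply.
  + exact: usc_compact_image_compact_structured.
  + exact: usc_compact_image_closed_subspace.
  + exact: usc_compact_image_continuous_image.
  + exact: usc_compact_image_compact_product.
- exact: usc_compact_image_weakly_structured.
Qed.
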